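(* Let $R>1$ be fixed and let $u=u_\varepsilon$ be the solution of the boundary value problem $$-\varepsilon\,\Delta u+u_x=0\ \text{ in }\Omega,\qquad u=0\ \text{ on }\partial\Omega_O,\qquad u_x=0\ \text{ on }\partial\Omega_N,\qquad u=1\ \text{ on }\partial\Omega_I,$$ with $\Omega,\partial\Omega_O,\partial\Omega_N,\partial\Omega_I$ as in the context. Write $\tilde u(r,\theta)=u(r\cos\theta,r\sin\theta)$. Then, for every constant $\mu>0$, there exist $\varepsilon_0>0$ and a constant $C>0$ independent of $\varepsilon$ and of the point $(x,y)$ such that for all $0<\varepsilon\le\varepsilon_0$ the following bounds hold at points $(x,y)\in\bar\Omega$: (a) $0\le u(x,y)\le 1$ for all $(x,y)\in\bar\Omega$; (b) $\tilde u(r,\theta)\le C\,e^{\cos(\theta)(r-1)/\varepsilon}$ for $\cos\theta\le 0$, $r\ge 1$; (c) $u(x,y)\le C\,e^{-(|y|-1)/\sqrt{\varepsilon}}$ for $|y|\ge 1$, $-R<x<R$; (d) $u(x,y)\le C\,e^{-(0.5x^2+|y|-1)/(3\varepsilon^{2/3})}$ for $x\in[-\varepsilon^{1/3},\varepsilon^{1/3}]$ and $-\mu\,\varepsilon^{2/3}\le 0.5x^2+|y|-1\le \mu\,\varepsilon^{2/3}$.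
   Context: The domain is $$\Omega=\{(x,y): 1<x^2+y^2<R^2,\ x\le 0\}\ \cup\ \{(x,y): -R<y<R,\ 0<x<R,\ 1<x^2+y^2\},$$ with boundary pieces $$\partial\Omega_N=\{(R,y): -R<y<R\},\qquad \partial\Omega_I=\{(x,y): x^2+y^2=1\},$$ $$\partial\Omega_O=\{(x,y): x^2+y^2=R^2,\ x\le 0\}\cup\{(x,y): y=\pm R,\ 0\le x\le R\}.$$ Here $(r,\theta)$ are polar coordinates. The solution $u$ is the classical solution, continuous on $\bar\Omega$ and $C^2$ in $\Omega$, with $u_x$ defined on $\partial\Omega_N$. *)

(* Defs.v *)
From HB Require Import structures.
From mathcomp Require Import all_boot all_order all_algebra.
From mathcomp Require Import all_classical all_reals all_analysis.

Set Implicit Arguments.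
Unset Strict Implicit.
Unset Printing Implicit Defensive.

Import Order.TTheory GRing.Theory Num.Theory.
Import numFieldNormedType.Exports.

Local Open Scope classical_set_scope.
Local Open Scope ring_scope.

(* A point (x, y) of the plane is a pair p : R * R, with x = p.1, y = p.2;
   rad is the outer radius. *)

Definition Omega (R : realType) (rad : R) : set (R * R) :=
  [set p | 1 < p.1 ^+ 2 + p.2 ^+ 2 < rad ^+ 2 /\ p.1 <= 0] `|`
  [set p | [/\ - rad < p.2 < rad, 0 < p.1 < rad & 1 < p.1 ^+ 2 + p.2 ^+ 2]].

Definition bdN (R : realType) (rad : R) : set (R * R) :=
  [set p | p.1 = rad /\ - rad < p.2 < rad].

Definition bdI (R : realType) : set (R * R) :=
  [set p | p.1 ^+ 2 + p.2 ^+ 2 = 1].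

Definition bdO (R : realType) (rad : R) : set (R * R) :=
  [set p | p.1 ^+ 2 + p.2 ^+ 2 = rad ^+ 2 /\ p.1 <= 0] `|`
  [set p | (p.2 = rad \/ p.2 = - rad) /\ 0 <= p.1 <= rad].

Definition dx (R : realType) (u : R * R -> R) : R * R -> R :=
  fun p => 'D_((1, 0) : R * R) u p.

Definition dy (R : realType) (u : R * R -> R) : R * R -> R :=
  fun p => 'D_((0, 1) : R * R) u p.

Definition laplacian (R : realType) (u : R * R -> R) : R * R -> R :=
  fun p => dx (dx u) p + dy (dy u) p.

(* 'D_v f p is a default value where the derivative does not exist, hence the
   separate derivability clause. *)
Definition C1_on (R : realType) (D : set (R * R)) (u : R * R -> R) : Prop :=
  [/\ forall p, D p -> derivable u p ((1, 0) : R * R) /\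
                       derivable u p ((0, 1) : R * R),
      {in D, continuous u}, {in D, continuous (dx u)} &
      {in D, continuous (dy u)}].

Definition C2_on (R : realType) (D : set (R * R)) (u : R * R -> R) : Prop :=
  [/\ C1_on D u, C1_on D (dx u) & C1_on D (dy u)].

(* Points of bdN are only approached from x < rad inside the domain, so u_x is
   the left derivative in x there. *)
Definition has_left_dx (R : realType) (u : R * R -> R) (p : R * R) (l : R) :
    Prop :=
  (u (x, p.2) - u p) / (x - p.1) @[x --> p.1^'-] --> l.

(* u is total on the plane, but its values outside the closure of Omega play
   no role. *)
Record classical_solution (R : realType) (rad eps : R) (u : R * R -> R) :
    Prop := ClassicalSolution {
  sol_continuous : {within closure (Omega rad), continuous u};
  sol_C2 : C2_on (Omega rad) u;
  sol_pde : forall p, Omega rad p -> - eps * laplacian u p + dx u p = 0;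
  sol_bdO : forall p, bdO rad p -> u p = 0;
  sol_bdN : forall p, bdN rad p -> has_left_dx u p 0;
  sol_bdI : forall p, bdI p -> u p = 1
}.

Definition polar (R : realType) (r theta : R) : R * R :=
  (r * cos theta, r * sin theta).

(* Main.v *)
Require Import Defs.
From HB Require Import structures.
From mathcomp Require Import all_boot all_order all_algebra.
From mathcomp Require Import all_classical all_reals all_analysis.
From mathcomp Require Import ring lra.

Import Order.TTheory GRing.Theory Num.Theory.
Import numFieldNormedType.Exports.

Local Open Scope classical_set_scope.
Local Open Scope ring_scope.

(** The equation has no zeroth-order term, so that a maximum principle holds,
    and the bounds follow by comparing the solution with explicit
    supersolutions of the operator [L v = - eps * Lap v + v_x].

    The maximum principle ([min_principle]) is elementary because [L x = 1] and
    [d x / d x = 1]: adding a small multiple of [x] to a supersolution makes it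
    strict both in the interior and on the Neumann side [x = rad], and the
    first and second derivative tests then exclude a negative minimum there.
    [comparison] applies it to the difference of a barrier and the solution on
    a closed part of the closure of the domain.

    (a) Compare with the constants 0 and 1 ([solution_bounds]).

    (b) On the half [x <= 0] the function [exp ((r - 1) * cos theta / eps)] is a
    supersolution ([polar_exponent_super]). It equals 1 on the unit circle and
    on the line [x = 0], and is positive on the outer boundary, so it dominates
    the solution ([solution_le_exp_polar]).

    (c) On [y >= 1], and symmetrically on [y <= -1], the function
    [exp (2 * (x + rad) - (|y| - 1) / sqrt eps)] is a supersolution when
    [eps <= 1 / 4]: the growth in x beats the term [1] produced by the decay
    in y. It is at least 1 on [|y| = 1], has a nonnegative slope at
    [x = rad], and its first factor is at most [exp (4 * rad)]
    ([solution_le_exp_y]).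

    (d) In the region considered the exponent is bounded by [mu / 3] in absolute
    value, so that (a) gives the bound with any constant at least [exp (mu / 3)]. *)

(** * Second-order jets of one-variable functions *)

(** The numbers [a] and [b] are the first and second derivatives of [f] at [x].
    Phrasing this through a function [g] that is the derivative of [f] around
    [x] keeps the hypothesis weaker than continuity of the second derivative
    and makes it stable under sums and exponentials. *)
Definition jet2 {R : realType} (f : R -> R) (x a b : R) : Prop :=
  exists g : R -> R,
    [/\ \forall t \near x, is_derive (t : R) (1 : R) f (g t), g x = a &
        is_derive x 1 g b].

Lemma near_itvP {R : realType} (x : R) (P : R -> Prop) :
  (\forall t \near x, P t) ->
  exists2 e, 0 < e & forall t, x - e < t < x + e -> P t.
Proof.
move=> /nbhs_ballP [e /= e0 xP]; exists e => // t ht.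
by apply: xP; rewrite /ball /= ltr_norml; lra.
Qed.

(** The second-derivative test. If [b < 0], then [g] vanishes at [x] and is
    negative just to the right of it, so that [f] decreases strictly there by
    the mean value theorem. *)
Lemma jet2_min {R : realType} (f : R -> R) (x a b : R) :
  jet2 f x a b -> (\forall t \near x, f x <= f t) -> a = 0 /\ 0 <= b.
Proof.
move=> [g [fg <- gb]] fmin; have gx0 : g x = 0.
  have [e e0 xe] := near_itvP _ _ fg; have [d d0 xd] := near_itvP _ _ fmin.
  have f0 : is_derive x 1 f 0.
    apply: (@derive1_at_min _ f (x - Num.min e d) (x + Num.min e d)).
    - by rewrite lerBlDr; case: (ltrP e d) => ?; lra.
    - move=> t; rewrite in_itv /= => ht; have /xe ? : x - e < t < x + e.
        by move: ht; case: (ltrP e d) => ?; lra.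
      exact: ex_derive.
    - by rewrite in_itv /=; case: (ltrP e d) => ?; lra.
    - move=> t; rewrite in_itv /= => ht; apply: xd.
      by move: ht; case: (ltrP e d) => ?; lra.
  have dx0 := nbhs_singleton fg.
  by rewrite -(@derive_val _ _ _ _ _ _ _ dx0) (@derive_val _ _ _ _ _ _ _ f0).
split=> //; rewrite leNgt; apply/negP => b0.
(* Caratheodory's form g t - g x = q t * (t - x), with q continuous at x and
   q x = b, turns the sign of b into a sign of g near x. *)
have [q [gq qc qx]] := (is_derive1_caratheodory g x b).1 gb.
have qneg : \forall t \near x, q t < 0.
  have : q t @[t --> x] --> q x by exact: qc.
  by move=> /cvgr_lt; apply; rewrite qx.
have [e e0 fe] := near_itvP _ _ fg; have [d d0 fd] := near_itvP _ _ fmin.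
have [h h0 qh] := near_itvP _ _ qneg.
pose m := Num.min e (Num.min d h).
have [m0 me md mh] : [/\ 0 < m, m <= e, m <= d & m <= h].
  by rewrite /m !lt_min e0 d0 h0 !ge_min !lexx !orbT.
have [] := @MVT R f g x (x + m / 2); first lra.
- by move=> t; rewrite in_itv /= => ?; apply: fe; lra.
- apply: derivable_within_continuous => t; rewrite in_itv /= => ht.
  by have ? := fe t ltac:(lra); exact: ex_derive.
move=> c; rewrite in_itv /= => hc fE.
have qc0 := qh c ltac:(lra); have fz := fd (x + m / 2) ltac:(lra).
have := gq c; rewrite gx0 subr0 => gcE; move: fE; rewrite gcE => fE.
have : q c * ((c - x) * (x + m / 2 - x)) < 0.
  by rewrite nmulr_rlt0 //; apply: mulr_gt0; lra.
by rewrite mulrA -fE; lra.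
Qed.

(** Smooth barriers extend across the line x = rad, so that their left
    derivative there is the ordinary one. *)
Lemma jet2_left_dx {R : realType} (v : R * R -> R) (p : R * R) (a b : R) :
  jet2 (fun t => v (t, p.2)) p.1 a b -> has_left_dx v p a.
Proof.
move=> [g [fg ga _]]; have := nbhs_singleton fg; rewrite ga.
move=> /is_derive1_caratheodory [q [qE qc qx]]; rewrite /has_left_dx -qx.
have : q x @[x --> p.1^'-] --> q p.1.
  by apply: cvg_dnbhs_at_left; apply: cvg_within_filter; exact: qc.
apply: cvg_trans; apply: near_eq_cvg; near=> t.
have tlt : t < p.1 by near: t; exact: withinT.
have tp : t - p.1 != 0 by rewrite subr_eq0 lt_eqF.
by have := qE t; rewrite /= -surjective_pairing => ->; rewrite mulfK.
Unshelve. all: by end_near.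
Qed.

Lemma jet2_cst {R : realType} (k x : R) : jet2 (fun=> k) x 0 0.
Proof.
by exists (fun=> 0); split=> //; [near=> t|]; exact: is_derive_cst.
Unshelve. all: by end_near.
Qed.

Lemma jet2_affine {R : realType} (m k x : R) : jet2 (fun t => m * t + k) x m 0.
Proof.
exists (fun=> m); split=> //; last exact: is_derive_cst.
near=> t; apply: is_derive_eq.
by rewrite addr0 /GRing.scale /=; ring.
Unshelve. all: by end_near.
Qed.

Lemma jet2_comb {R : realType} (f g : R -> R) (k x a b a' b' : R) :
  jet2 f x a b -> jet2 g x a' b' ->
  jet2 (fun t => f t + k * g t) x (a + k * a') (b + k * b').
Proof.
move=> [F [fF <- Fb]] [G [gG <- Gb]].
exists (fun t => F t + k * G t); split => //.
  near=> t.
  have ? : is_derive t 1 f (F t) by near: t.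
  have ? : is_derive t 1 g (G t) by near: t.
  by apply: is_derive_eq; rewrite /GRing.scale /=; ring.
by apply: is_derive_eq; rewrite /GRing.scale /=; ring.
Unshelve. all: by end_near.
Qed.

Lemma jet2_expR {R : realType} (f : R -> R) (x a b : R) :
  jet2 f x a b ->
  jet2 (fun t => expR (f t)) x (a * expR (f x)) ((b + a ^+ 2) * expR (f x)).
Proof.
move=> [F [fF <- Fb]].
have dexp (t : R) : is_derive t 1 f (F t) ->
    is_derive t 1 (fun t => expR (f t)) (F t * expR (f t)).
  by move=> ft; have := is_derive1_comp (is_derive_expR (f t)) ft; rewrite mulrC.
exists (fun t => F t * expR (f t)); split => //.
  by apply: filterS fF => t; exact: dexp.
have ? := dexp x (nbhs_singleton fF).
by apply: is_derive_eq; rewrite /GRing.scale /=; ring.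
Qed.

(** * Partial derivatives as derivatives of slices *)

Lemma is_derive_slice1 {R : realType} (u : R * R -> R) (x y : R) :
  derivable u (x, y) ((1, 0) : R * R) ->
  is_derive x 1 (fun t => u (t, y)) (dx u (x, y)).
Proof.
have E : (fun h : R => h^-1 *: (((fun t => u (t, y)) \o shift x) (h *: 1)
            - u (x, y)))
       = (fun h : R => h^-1 *: ((u \o shift (x, y)) (h *: ((1, 0) : R * R))
            - u (x, y))).
  apply/funext => h /=; congr (_ *: (u _ - _)).
  by rewrite /GRing.scale /= /GRing.add /= /add_pair /=; congr pair;
    rewrite /GRing.scale /= mulr0 add0r.
move=> du; apply: DeriveDef; first by rewrite /derivable E.
by rewrite /dx /derive E.
Qed.

Lemma is_derive_slice2 {R : realType} (u : R * R -> R) (x y : R) :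
  derivable u (x, y) ((0, 1) : R * R) ->
  is_derive y 1 (fun t => u (x, t)) (dy u (x, y)).
Proof.
have E : (fun h : R => h^-1 *: (((fun t => u (x, t)) \o shift y) (h *: 1)
            - u (x, y)))
       = (fun h : R => h^-1 *: ((u \o shift (x, y)) (h *: ((0, 1) : R * R))
            - u (x, y))).
  apply/funext => h /=; congr (_ *: (u _ - _)).
  by rewrite /GRing.scale /= /GRing.add /= /add_pair /=; congr pair;
    rewrite /GRing.scale /= mulr0 add0r.
move=> du; apply: DeriveDef; first by rewrite /derivable E.
by rewrite /dy /derive E.
Qed.

Lemma near_slice1 {R : realType} (K : set (R * R)) (p : R * R) :
  nbhs p K -> \forall t \near p.1, K (t, p.2).
Proof.
case: p => x y /= Kp; have : (t, y) @[t --> x] --> (x, y).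
  by apply: (@cvg_pair _ _ _ (nbhs x) (nbhs x) (nbhs y) _ _ _ id (fun=> y));
    [exact: cvg_id|exact: cvg_cst].
exact.
Qed.

Lemma near_slice2 {R : realType} (K : set (R * R)) (p : R * R) :
  nbhs p K -> \forall t \near p.2, K (p.1, t).
Proof.
case: p => x y /= Kp; have : (x, t) @[t --> y] --> (x, y).
  by apply: (@cvg_pair _ _ _ (nbhs y) (nbhs x) (nbhs y) _ _ _ (fun=> x) id);
    [exact: cvg_cst|exact: cvg_id].
exact.
Qed.

Lemma C2_on_jet2 {R : realType} (D : set (R * R)) (u : R * R -> R) (p : R * R) :
  open D -> C2_on D u -> D p ->
  jet2 (fun t => u (t, p.2)) p.1 (dx u p) (dx (dx u) p) /\
  jet2 (fun t => u (p.1, t)) p.2 (dy u p) (dy (dy u) p).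
Proof.
move=> Dop [[du _ _ _] [dxu _ _ _] [dyu _ _ _]] Dp.
have nD : nbhs p D by exact: open_nbhs_nbhs.
split.
  exists (fun t => dx u (t, p.2)); split; last 2 first.
  - by rewrite -surjective_pairing.
  - rewrite [in X in is_derive _ _ _ X](surjective_pairing p).
    by apply: is_derive_slice1; rewrite -surjective_pairing; case: (dxu _ Dp).
  near=> t; have Dt : D (t, p.2) by near: t; exact: near_slice1.
  by apply: is_derive_slice1; case: (du _ Dt).
exists (fun t => dy u (p.1, t)); split; last 2 first.
- by rewrite -surjective_pairing.
- rewrite [in X in is_derive _ _ _ X](surjective_pairing p).
  by apply: is_derive_slice2; rewrite -surjective_pairing; case: (dyu _ Dp).
near=> t; have Dt : D (p.1, t) by near: t; exact: near_slice2.
by apply: is_derive_slice2; case: (du _ Dt).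
Unshelve. all: by end_near.
Qed.

(** * The minimum principle *)

(** [a], [b] are the first and second derivatives in x, and [c], [d] those in
    y: no mixed derivative enters the operator. *)
Definition jets {R : realType} (w : R * R -> R) (p : R * R) (a b c d : R) :=
  jet2 (fun t => w (t, p.2)) p.1 a b /\ jet2 (fun t => w (p.1, t)) p.2 c d.

(** The weak minimum principle for -eps * Laplacian + d/dx on a compact [K],
    each point of which is of one of three kinds: the sign is known there, or
    it is interior and [w] is a supersolution there, or [K] contains the points
    just to its left and the outward slope is nonnegative there (Neumann).
    The perturbation [k * (x - x_min)] of [w] makes the last two kinds strict,
    because its derivative in x is [k > 0] and its Laplacian vanishes; a
    strict supersolution cannot have a minimum at such points. *)
Lemma min_principle {R : realType} (eps : R) (K : set (R * R))
    (w : R * R -> R) :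
  0 < eps -> compact K -> {within K, continuous w} ->
  (forall p, K p ->
    [\/ 0 <= w p,
        nbhs p K /\ (exists a b c d,
          jets w p a b c d /\ 0 <= - eps * (b + d) + a)
      | (\forall x \near p.1^'-, K (x, p.2)) /\
        exists2 l, has_left_dx w p l & 0 <= l]) ->
  forall p, K p -> 0 <= w p.
Proof.
move=> eps0 cK cw wK p Kp; have K0 : K !=set0 by exists p.
have fstK : {within K, continuous (fst : R * R -> R)}.
  by apply: continuous_in_subspaceT => q _; exact: cvg_fst.
have [m mK mmin] := compact_EVT_min K0 cK fstK.
have pm0 : 0 <= p.1 - m.1 by rewrite subr_ge0; apply: mmin; rewrite inE.
apply/ler_addgt0Pr => e e0.
(* m.1 is the least abscissa in K, so the perturbation is nonnegative on K,
   and k is small enough for it to be at most e at the point p. *)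
pose k := e / (p.1 - m.1 + 1).
have k0 : 0 < k by apply: divr_gt0 => //; lra.
have ke : k * (p.1 - m.1) <= e.
  by rewrite /k mulrAC ler_pdivrMr; [nra|lra].
pose W q := w q + k * (q.1 - m.1).
suff Wge0 q : K q -> 0 <= W q by have := Wge0 p Kp; rewrite /W; lra.
have cW : {within K, continuous W}.
  move=> x; apply: cvgD; first exact: cw.
  apply: cvgM; first exact: cvg_cst.
  by apply: cvgB; [exact: fstK|exact: cvg_cst].
have [c cK' cmin] := compact_EVT_min K0 cK cW.
move=> Kq; apply: (@le_trans _ _ (W c)); last by apply: cmin; rewrite inE.
have mc : m.1 <= c.1 by apply: mmin.
have {}cmin r : K r -> W c <= W r by move=> ?; apply: cmin; rewrite inE.
move: cK'; rewrite inE => Kc.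
have [wc|[nc [a [b [a' [b' [[jx jy] Lw]]]]]]|[nc [l wl l0]]] := wK c Kc.
- by rewrite /W; apply: addr_ge0 => //; apply: mulr_ge0; lra.
- have jX := jet2_comb _ _ k _ _ _ _ _ jx (jet2_affine 1 (- m.1) c.1).
  have [] := jet2_min _ _ _ _ jX.
    apply: filterS (near_slice1 _ _ nc) => t /cmin.
    by rewrite /W /= -surjective_pairing !mul1r.
  have jY := jet2_comb _ _ k _ _ _ _ _ jy (jet2_affine 0 (c.1 - m.1) c.2).
  have [] := jet2_min _ _ _ _ jY.
    apply: filterS (near_slice2 _ _ nc) => t /cmin.
    by rewrite /W /= -surjective_pairing !mul0r !add0r.
  by move=> _ b'0 a0 b0; exfalso; nra.
- have lk : l + k <= 0.
    have : (w (x, c.2) - w c) / (x - c.1) + k @[x --> c.1^'-] --> l + k.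
      by apply: cvgD => //; exact: cvg_cst.
    move=> /cvgr_to_le; apply; near=> x.
    have xc : x < c.1 by near: x; exact: withinT.
    have Kx : K (x, c.2) by near: x.
    have := cmin _ Kx; rewrite /W /= => WW.
    have xc0 : x - c.1 < 0 by lra.
    rewrite -[X in _ + X](@mulfK _ (x - c.1)); last by rewrite lt_eqF.
    by rewrite -mulrDl ler_ndivrMr // mul0r; lra.
  by lra.
Unshelve. all: by end_near.
Qed.

(** * Geometry of the domain *)

Lemma open_lt2 {R : realType} (f g : R * R -> R) :
  continuous f -> continuous g -> open [set p | f p < g p].
Proof.
move=> cf cg.
have -> : [set p | f p < g p] = (fun p => g p - f p) @^-1` [set x | 0 < x].
  by apply/seteqP; split => p /=; rewrite subr_gt0.
apply: open_comp; last exact: open_gt.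
by move=> p _; apply: cvgB; [exact: cg|exact: cf].
Qed.

Lemma closed_le2 {R : realType} (f g : R * R -> R) :
  continuous f -> continuous g -> closed [set p | f p <= g p].
Proof.
move=> cf cg.
have -> : [set p | f p <= g p] = ~` [set p | g p < f p].
  by apply/seteqP; split => p /=; rewrite leNgt => /negP.
by apply: open_closedC; exact: open_lt2.
Qed.

Lemma continuous_sqr_norm {R : realType} :
  continuous (fun p : R * R => p.1 ^+ 2 + p.2 ^+ 2).
Proof.
move=> p; apply: cvgD.
  apply: (@continuous_comp _ _ _ fst (fun t : R => t ^+ 2)).
    exact: cvg_fst.
  exact: exprn_continuous.
apply: (@continuous_comp _ _ _ snd (fun t : R => t ^+ 2)).
  exact: cvg_snd.
exact: exprn_continuous.
Qed.

Lemma fst_continuous {R : realType} : continuous (fst : R * R -> R).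
Proof. by move=> p; exact: cvg_fst. Qed.

Lemma snd_continuous {R : realType} : continuous (snd : R * R -> R).
Proof. by move=> p; exact: cvg_snd. Qed.

Lemma cst_continuous2 {R : realType} (k : R) : continuous (fun _ : R * R => k).
Proof. by move=> p; exact: cvg_cst. Qed.

(** On the left half, |y| < rad and |x| < rad follow from the bound on the
    radius; this lets both halves of the domain share one description. *)
Lemma sqr_norm_lt_itv {R : realType} (r x y : R) : 0 <= r ->
  x ^+ 2 + y ^+ 2 < r ^+ 2 -> (- r < x < r) /\ (- r < y < r).
Proof.
move=> r0 nr; rewrite -!ltr_norml -!(ltr_sqr (normr_ge0 _)) ?nnegrE //.
by rewrite !real_normK ?num_real //; have := sqr_ge0 x; have := sqr_ge0 y; lra.
Qed.

Lemma Omega_open {R : realType} (rad : R) : 1 < rad -> open (Omega rad).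
Proof.
move=> rad1; have -> : Omega rad =
    [set p | 1 < p.1 ^+ 2 + p.2 ^+ 2] `&` [set p | p.1 < rad] `&`
    [set p | p.2 < rad] `&` [set p | - rad < p.2] `&`
    ([set p | 0 < p.1] `|` [set p | p.1 ^+ 2 + p.2 ^+ 2 < rad ^+ 2]).
  apply/seteqP; split => [[x y]|[x y]]; rewrite /Omega /=.
    move=> [[/andP[? nr] ?]|[/andP[? ?] /andP[? ?] ?]].
      have [? ?] := sqr_norm_lt_itv rad x y ltac:(lra) nr.
      by split; [split; [split; [split|]|]|right]; lra.
    by split; [split; [split; [split|]|]|left]; lra.
  move=> [[[[? ?] ?] ?] h]; case: (lerP x 0) => x0; [left|right].
    by case: h => h; split => //; try apply/andP; try split; lra.
  by split; try apply/andP; try split; lra.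
have cf := @fst_continuous R; have cs := @snd_continuous R.
have cn := @continuous_sqr_norm R.
have cc := @cst_continuous2 R.
apply: openI; last by apply: openU; apply: open_lt2.
by do 3 ?[apply: openI]; apply: open_lt2.
Qed.

Lemma nbhs_closure_Omega {R : realType} (rad : R) (p : R * R) : 1 < rad ->
  Omega rad p -> nbhs p (closure (Omega rad)).
Proof.
move=> rad1 Op; apply: filterS (@subset_closure _ _) _.
by apply: open_nbhs_nbhs; split => //; exact: Omega_open.
Qed.

(** The right-hand side is closed and contains the domain. It serves to place
    every point of the closure either in the domain or on one of the three
    boundary pieces. *)
Lemma closure_Omega_sub {R : realType} (rad : R) : 1 < rad ->
  closure (Omega rad) `<=`
  [set p | [/\ 1 <= p.1 ^+ 2 + p.2 ^+ 2, - rad <= p.1 <= rad,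
               - rad <= p.2 <= rad &
               p.1 <= 0 -> p.1 ^+ 2 + p.2 ^+ 2 <= rad ^+ 2]].
Proof.
move=> rad1; rewrite closureE; apply: smallest_sub; last first.
  move=> [x y]; rewrite /Omega /=.
  move=> [[/andP[? nr] ?]|[/andP[? ?] /andP[? ?] ?]]; last by split; lra.
  have [? ?] := sqr_norm_lt_itv rad x y ltac:(lra) nr.
  by split; lra.
have -> : [set p : R * R | [/\ 1 <= p.1 ^+ 2 + p.2 ^+ 2, - rad <= p.1 <= rad,
               - rad <= p.2 <= rad &
               p.1 <= 0 -> p.1 ^+ 2 + p.2 ^+ 2 <= rad ^+ 2]] =
    [set p | 1 <= p.1 ^+ 2 + p.2 ^+ 2] `&`
    [set p | p.1 <= rad] `&` [set p | - rad <= p.1] `&`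
    [set p | p.2 <= rad] `&` [set p | - rad <= p.2] `&`
    ([set p | 0 <= p.1] `|` [set p | p.1 ^+ 2 + p.2 ^+ 2 <= rad ^+ 2]).
  apply/seteqP; split => [[x y]|[x y]] /=.
    move=> [? /andP[? ?] /andP[? ?] h].
    split; first by split; [split; [split; [split|]|]|]; lra.
    by case: (lerP x 0) => x0; [right; exact: h|left; lra].
  move=> [[[[[? ?] ?] ?] ?] h]; split; [lra|lra|lra|] => x0.
  case: h => // x0'; have -> : x = 0 by lra.
  rewrite expr0n add0r -[y ^+ 2]real_normK ?num_real //.
  by rewrite ler_sqr ?nnegrE // ?ler_norml; lra.
have cf := @fst_continuous R; have cs := @snd_continuous R.
have cn := @continuous_sqr_norm R.
have cc := @cst_continuous2 R.
apply: closedI; last by apply: closedU; apply: closed_le2.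
by do 4 ?[apply: closedI]; apply: closed_le2.
Qed.

Lemma closure_OmegaP {R : realType} (rad : R) (p : R * R) : 1 < rad ->
  closure (Omega rad) p -> [\/ Omega rad p, bdO rad p, bdN rad p | bdI p].
Proof.
move=> rad1 /closure_Omega_sub - /(_ rad1); case: p => x y /=.
rewrite /Omega /bdO /bdN /bdI /= => -[n1 /andP[xl xr] /andP[yl yr] xn].
have [n1'|n1'|n1'] := ltrgtP 1 (x ^+ 2 + y ^+ 2); last 2 first.
- by lra.
- by constructor 4.
have [x0|x0] := lerP x 0.
  have [nr|nr|nr] := ltrgtP (x ^+ 2 + y ^+ 2) (rad ^+ 2).
  - by constructor 1; left.
  - by have := xn x0; lra.
  - by constructor 2; left.
have [yr'|yr'|yr'] := ltrgtP y rad; last 2 first.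
- by lra.
- by constructor 2; right; split; [left|lra].
have [yl'|yl'|yl'] := ltrgtP (- rad) y; last 2 first.
- by lra.
- by constructor 2; right; split; [right|lra].
have [xr'|xr'|xr'] := ltrgtP x rad.
- by constructor 1; right; split => //; apply/andP; split.
- by lra.
- by constructor 3; split => //; apply/andP; split.
Qed.

Lemma closure_Omega_compact {R : realType} (rad : R) :
  1 < rad -> compact (closure (Omega rad)).
Proof.
move=> rad1; apply: (@subclosed_compact _ _ (`[- rad, rad] `*` `[- rad, rad])).
- exact: closed_closure.
- by apply: compact_setX; exact: segment_compact.
- by move=> p /closure_Omega_sub - /(_ rad1) [_ ? ? _]; split; rewrite /= in_itv.
Qed.

(** * Comparison with the solution *)

Lemma bdN_near_left {R : realType} (rad : R) (p : R * R) : 1 < rad ->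
  bdN rad p -> \forall x \near p.1^'-, Omega rad (x, p.2).
Proof.
move=> rad1 [pE py]; near=> x; right => /=.
have x1 : 1 < x by near: x; apply: nbhs_left_gt; rewrite pE.
have xr : x < rad by rewrite -pE; near: x; exact: withinT.
split => //; first by apply/andP; split => //; lra.
by have := sqr_ge0 p.2; rewrite (expr2 x); nra.
Unshelve. all: by end_near.
Qed.

Lemma solution_jets {R : realType} (rad eps : R) (u : R * R -> R) (p : R * R) :
  1 < rad -> classical_solution rad eps u -> Omega rad p ->
  exists a b c d, jets u p a b c d /\ - eps * (b + d) + a = 0.
Proof.
move=> rad1 su Op.
have [jx jy] := C2_on_jet2 _ _ _ (Omega_open _ rad1) (sol_C2 su) Op.
exists (dx u p), (dx (dx u) p), (dy u p), (dy (dy u) p); split; first by split.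
exact: (sol_pde su).
Qed.

(** A barrier [v] dominates the solution on a closed piece [K] of the domain
    as soon as it does so on the part of the boundary of [K] that is not on
    the Neumann side: [v - u] satisfies the minimum principle because the
    operator and the boundary condition are linear. Working on a piece [K]
    allows barriers that are supersolutions only there. *)
Lemma comparison {R : realType} (rad eps : R) (u v : R * R -> R)
    (K : set (R * R)) :
  1 < rad -> 0 < eps -> classical_solution rad eps u ->
  closed K -> K `<=` closure (Omega rad) -> {in K, continuous v} ->
  (forall p, K p ->
    [\/ u p <= v p,
        [/\ Omega rad p, nbhs p K & exists a b c d,
          jets v p a b c d /\ 0 <= - eps * (b + d) + a]
      | [/\ bdN rad p, \forall x \near p.1^'-, K (x, p.2) &
          exists2 l, has_left_dx v p l & 0 <= l]]) ->
  forall p, K p -> u p <= v p.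
Proof.
move=> rad1 eps0 su clK KO cv H p Kp.
suff : 0 <= v p + -1 * u p by lra.
move: p Kp; apply: (@min_principle R eps) => //.
- exact: subclosed_compact clK (closure_Omega_compact _ rad1) KO.
- have cu := continuous_subspaceW KO (sol_continuous su).
  have cv' := continuous_in_subspaceT cv.
  move=> x; apply: cvgD; first exact: cv'.
  by apply: cvgM; [exact: cvg_cst|exact: cu].
- move=> p Kp; have [uv|[Op nK [a [b [c [d [[jx jy] Lv]]]]]]|[bp nK [l vl l0]]] :=
    H p Kp.
  + by constructor 1; lra.
  + have [a' [b' [c' [d' [[jx' jy'] Lu]]]]] := solution_jets _ _ _ _ rad1 su Op.
    constructor 2; split => //.
    exists (a + -1 * a'), (b + -1 * b'), (c + -1 * c'), (d + -1 * d'); split.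
      by split; exact: jet2_comb.
    by lra.
  + constructor 3; split => //; exists l => //.
    have ul := sol_bdN su bp.
    have : (v (x, p.2) - v p) / (x - p.1) - (u (x, p.2) - u p) / (x - p.1)
      @[x --> p.1^'-] --> l - 0 by apply: cvgB; [exact: vl|exact: ul].
    rewrite subr0; apply: cvg_trans; apply: near_eq_cvg; apply: nearW => x.
    by rewrite -mulrBl; congr (_ / _); ring.
Qed.

(** The constants 0 and 1 solve the equation and the Neumann condition, and
    they bound the Dirichlet data. *)
Lemma solution_bounds {R : realType} (rad eps : R) (u : R * R -> R) :
  1 < rad -> 0 < eps -> classical_solution rad eps u ->
  forall p, closure (Omega rad) p -> 0 <= u p <= 1.
Proof.
move=> rad1 eps0 su p Op; apply/andP; split.
  move: p Op; apply: (@min_principle R eps) => //.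
  - exact: closure_Omega_compact.
  - exact: sol_continuous su.
  move=> p Op; have [Op'|bp|bp|bp] := closure_OmegaP _ _ rad1 Op.
  - constructor 2; split; first exact: nbhs_closure_Omega.
    have [a [b [c [d [ju Lu]]]]] := solution_jets _ _ _ _ rad1 su Op'.
    by exists a, b, c, d; split => //; rewrite Lu.
  - by constructor 1; rewrite (sol_bdO su).
  - constructor 3; split; last by exists 0; [exact: (sol_bdN su bp)|].
    by apply: filterS (bdN_near_left _ _ rad1 bp) => x; exact: subset_closure.
  - by constructor 1; rewrite (sol_bdI su).
apply: (@comparison R rad eps u (fun=> 1) (closure (Omega rad))) => //.
- exact: closed_closure.
- by move=> q _; exact: cvg_cst.
move=> q Oq; have [Oq'|bq|bq|bq] := closure_OmegaP _ _ rad1 Oq.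
- constructor 2; split => //; first exact: nbhs_closure_Omega.
  exists 0, 0, 0, 0; split; last by lra.
  by split; exact: jet2_cst.
- by constructor 1; rewrite (sol_bdO su).
- constructor 3; split => //.
    by apply: filterS (bdN_near_left _ _ rad1 bq) => x; exact: subset_closure.
  by exists 0; [exact: (jet2_left_dx (fun=> 1) q _ _ (jet2_cst 1 q.1))|].
- by constructor 1; rewrite (sol_bdI su).
Qed.

(** * The barrier away from the strip |y| < 1 *)

Lemma jets_affine {R : realType} (m n k : R) (p : R * R) :
  jets (fun q => m * q.1 + n * q.2 + k) p m 0 n 0.
Proof.
split => /=.
  rewrite (_ : (fun t => _) = (fun t => m * t + (n * p.2 + k))).
    exact: jet2_affine.
  by apply/funext => t; ring.
rewrite (_ : (fun t => _) = (fun t => n * t + (m * p.1 + k))).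
  exact: jet2_affine.
by apply/funext => t; ring.
Qed.

(** For a barrier [exp f] the supersolution inequality becomes an eikonal-type
    inequality for the exponent [f] alone, since
    [L (exp f) = exp f * (f_x - eps * (Lap f + |grad f|^2))]. *)
Lemma jets_expR {R : realType} (f : R * R -> R) (eps : R) (p : R * R)
    (a b c d : R) :
  jets f p a b c d -> eps * (b + d + a ^+ 2 + c ^+ 2) <= a ->
  exists a' b' c' d', jets (fun q => expR (f q)) p a' b' c' d' /\
    0 <= - eps * (b' + d') + a'.
Proof.
move=> [/jet2_expR jx /jet2_expR jy] L; move: jx jy => /=.
rewrite -surjective_pairing; set e := expR (f p) => jx jy.
exists (a * e), ((b + a ^+ 2) * e), (c * e), ((d + c ^+ 2) * e).
split; first by split.
have -> : - eps * ((b + a ^+ 2) * e + (d + c ^+ 2) * e) + a * e =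
    (a - eps * (b + d + a ^+ 2 + c ^+ 2)) * e by ring.
by apply: mulr_ge0; [lra|exact: expR_ge0].
Qed.

(** The factor [exp (- |y| / sqrt eps)] contributes [-1] to the operator, and
    the factor [exp (2 * x)] contributes [2 - 4 * eps >= 1], which compensates
    it. The sign [s] selects the half-plane above or below the disk; there the
    solution is at most 1 on the line [s * y = 1], where the barrier is at least
    1 because [x >= - rad]. *)
Lemma solution_le_exp_y {R : realType} (rad eps s : R) (u : R * R -> R) :
  1 < rad -> 0 < eps -> eps <= 4^-1 -> s ^+ 2 = 1 ->
  classical_solution rad eps u ->
  forall p, closure (Omega rad) p -> 1 <= s * p.2 ->
  u p <= expR (2 * (p.1 + rad) - (s * p.2 - 1) / Num.sqrt eps).
Proof.
move=> rad1 eps0 eps4 s1 su p Op sp.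
have se0 : 0 < Num.sqrt eps by rewrite sqrtr_gt0.
pose q := (Num.sqrt eps)^-1.
have q2 : eps * q ^+ 2 = 1.
  by rewrite /q exprVn sqr_sqrtr ?ltW // mulfV // gt_eqF.
pose phi (p : R * R) := 2 * p.1 + (- (s * q)) * p.2 + (2 * rad + q).
have phiE (r : R * R) :
    2 * (r.1 + rad) - (s * r.2 - 1) / Num.sqrt eps = phi r.
  by rewrite /phi -/q; ring.
have jphi r : exists a' b' c' d', jets (fun q => expR (phi q)) r a' b' c' d' /\
    0 <= - eps * (b' + d') + a'.
  apply: jets_expR (jets_affine _ _ _ r) _.
  by rewrite sqrrN exprMn s1; lra.
rewrite phiE.
pose K := closure (Omega rad) `&` [set r | 1 <= s * r.2].
have cf := @fst_continuous R; have cs := @snd_continuous R.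
have csy : continuous (fun r : R * R => s * r.2).
  by move=> r; apply: cvgM; [exact: cvg_cst|exact: cs].
apply: (@comparison R rad eps u (fun r => expR (phi r)) K) => //.
- apply: closedI; first exact: closed_closure.
  by apply: closed_le2; first exact: cst_continuous2.
- by move=> r [].
- move=> r _; apply: (@continuous_comp _ _ _ phi expR); last first.
    exact: continuous_expR.
  apply: cvgD; last exact: cvg_cst.
  by apply: cvgD; apply: cvgM; [exact: cvg_cst|exact: cf|exact: cvg_cst|exact: cs].
move=> r [Or /= sr].
have r1rad : - rad <= r.1.
  by have [_ /andP[]] := closure_Omega_sub _ rad1 _ Or.
have /andP[ur0 ur1] := solution_bounds _ _ _ rad1 eps0 su _ Or.
have [sr1|sr1] := eqVneq (s * r.2) 1.
  constructor 1; apply: (le_trans ur1); rewrite -phiE sr1 subrr mul0r subr0.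
  by rewrite -[leLHS]expR0 ler_expR; lra.
have {}sr1 : 1 < s * r.2 by rewrite lt_neqAle eq_sym sr1.
have r2 : 1 < r.2 ^+ 2.
  have <- : (s * r.2) ^+ 2 = r.2 ^+ 2 by rewrite exprMn s1 mul1r.
  by rewrite expr2; nra.
have [Or'|br|[br1 br2]|br] := closure_OmegaP _ _ rad1 Or.
- constructor 2; split => //.
  have : nbhs r (Omega rad `&` [set r | 1 < s * r.2]).
    apply: open_nbhs_nbhs; split => //; apply: openI; first exact: Omega_open.
    by apply: open_lt2; first exact: cst_continuous2.
  by apply: filterS => r' [? /ltW ?]; split => //; exact: subset_closure.
- by constructor 1; rewrite (sol_bdO su) // expR_ge0.
- constructor 3; split => //.
    apply: filterS (bdN_near_left _ _ rad1 (conj br1 br2)) => x ?; split => //.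
    exact: subset_closure.
  have [jx _] := jets_affine 2 (- (s * q)) (2 * rad + q) r.
  have jx' := jet2_expR _ _ _ _ jx.
  eexists; first exact: (jet2_left_dx (fun r => expR (phi r)) r _ _ jx').
  by apply: mulr_ge0; [lra|exact: expR_ge0].
- by move: br; rewrite /bdI /=; have := sqr_ge0 r.1; lra.
Qed.

(** * The polar barrier upstream of the disk *)

Lemma is_derive_inv_radius {R : realType} (k t : R) : 0 < t ^+ 2 + k ->
  is_derive t 1 (fun t => (Num.sqrt (t ^+ 2 + k))^-1)
    (- t * (Num.sqrt (t ^+ 2 + k))^-1 ^+ 3).
Proof.
move=> tk0; have s0 : 0 < Num.sqrt (t ^+ 2 + k) by rewrite sqrtr_gt0.
have dq : is_derive t 1 (fun t : R => t ^+ 2 + k) (2 * t).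
  by apply: is_derive_eq; rewrite /GRing.scale /=; ring.
have ds := @is_derive1_comp R Num.sqrt (fun t => t ^+ 2 + k) t _ _
  (is_derive1_sqrt tk0) dq.
have := @is_deriveV R (Num.sqrt \o (fun t => t ^+ 2 + k)) t _ _
  (lt0r_neq0 s0) ds.
move=> /is_derive_eq; apply; rewrite /GRing.scale /=.
by field; rewrite gt_eqF.
Qed.

Lemma near_radius_gt0 {R : realType} (k x : R) : 0 < x ^+ 2 + k ->
  \forall t \near x, 0 < t ^+ 2 + k.
Proof.
move=> xk; have : t ^+ 2 + k @[t --> x] --> x ^+ 2 + k.
  by apply: cvgD; [exact: exprn_continuous|exact: cvg_cst].
by move=> /cvgr_gt; apply.
Qed.

Lemma jet2_inv_radius {R : realType} (k x : R) : 0 < x ^+ 2 + k ->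
  let rho := (Num.sqrt (x ^+ 2 + k))^-1 in
  jet2 (fun t => (Num.sqrt (t ^+ 2 + k))^-1) x
    (- x * rho ^+ 3) (- rho ^+ 3 + 3 * x ^+ 2 * rho ^+ 5).
Proof.
move=> xk rho.
exists (fun t => - t * (Num.sqrt (t ^+ 2 + k))^-1 ^+ 3); split => //.
  near=> t; apply: is_derive_inv_radius; near: t; exact: near_radius_gt0.
have ? := is_derive_inv_radius k x xk.
by apply: is_derive_eq; rewrite /GRing.scale /= -/rho; ring.
Unshelve. all: by end_near.
Qed.

Lemma jet2_id_inv_radius {R : realType} (k x : R) : 0 < x ^+ 2 + k ->
  let rho := (Num.sqrt (x ^+ 2 + k))^-1 in
  jet2 (fun t => t * (Num.sqrt (t ^+ 2 + k))^-1) x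
    (rho - x ^+ 2 * rho ^+ 3) (- 3 * x * rho ^+ 3 + 3 * x ^+ 3 * rho ^+ 5).
Proof.
move=> xk rho.
exists (fun t => (Num.sqrt (t ^+ 2 + k))^-1 -
                 t ^+ 2 * (Num.sqrt (t ^+ 2 + k))^-1 ^+ 3); split => //.
  near=> t; have tk : 0 < t ^+ 2 + k by near: t; exact: near_radius_gt0.
  have ? := is_derive_inv_radius k t tk.
  by apply: is_derive_eq; rewrite /GRing.scale /=; ring.
have ? := is_derive_inv_radius k x xk.
by apply: is_derive_eq; rewrite /GRing.scale /= -/rho; ring.
Unshelve. all: by end_near.
Qed.

(** The supersolution inequality for the exponent
    [phi = (r - 1) * cos theta / eps = (x - x / r) / eps], with [z] standing for
    [1 / r]; [a], [b], [c], [d] are its derivatives. Here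
    [eps * Lap phi = x / r^3 <= 0], and
    [phi_x - eps * |grad phi|^2 = (y^2 / r^2) * (1 / r) * (1 - 1 / r) / eps],
    which is nonnegative outside the unit disk. *)
Lemma polar_exponent_super {R : realFieldType} (eps x y z : R) :
  0 < eps -> x <= 0 -> 0 < z -> z <= 1 -> z ^+ 2 * (x ^+ 2 + y ^+ 2) = 1 ->
  let a := eps^-1 + - eps^-1 * (z - x ^+ 2 * z ^+ 3) in
  let b := 0 + - eps^-1 * (- 3 * x * z ^+ 3 + 3 * x ^+ 3 * z ^+ 5) in
  let c := 0 + - (eps^-1 * x) * (- y * z ^+ 3) in
  let d := 0 + - (eps^-1 * x) * (- z ^+ 3 + 3 * y ^+ 2 * z ^+ 5) in
  is_true (eps * (b + d + a ^+ 2 + c ^+ 2) <= a).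
Proof.
move=> eps0 x0 z0 z1 zn a b c d.
(* Eliminating y through z^2 * y^2 = 1 - z^2 * x^2 reduces the claim to the two
   nonnegative terms of the last identity. *)
have yE : z ^+ 2 * y ^+ 2 = 1 - z ^+ 2 * x ^+ 2 by lra.
have -> : eps * (b + d + a ^+ 2 + c ^+ 2) =
    4 * (x * z ^+ 3) - 3 * (x * z ^+ 3) * (z ^+ 2 * (x ^+ 2 + y ^+ 2)) +
    eps^-1 * ((1 - z + x ^+ 2 * z ^+ 3) ^+ 2 + x ^+ 2 * z ^+ 4 * (z ^+ 2 * y ^+ 2)).
  by rewrite /a /b /c /d; field; rewrite gt_eqF.
rewrite zn yE -subr_ge0.
have -> : a - (4 * (x * z ^+ 3) - 3 * (x * z ^+ 3) * 1 +
    eps^-1 * ((1 - z + x ^+ 2 * z ^+ 3) ^+ 2 +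
              x ^+ 2 * z ^+ 4 * (1 - z ^+ 2 * x ^+ 2))) =
    (- x) * z ^+ 3 + eps^-1 * ((1 - z ^+ 2 * x ^+ 2) * (z * (1 - z))).
  by rewrite /a; ring.
rewrite -yE; apply: addr_ge0.
  by apply: mulr_ge0; [lra|rewrite exprn_ge0 // ltW].
apply: mulr_ge0; first by rewrite invr_ge0 ltW.
by apply: mulr_ge0; [rewrite mulr_ge0 ?sqr_ge0|apply: mulr_ge0; [exact: ltW|lra]].
Qed.

(** For [x > 0] the barrier need not be a supersolution. On the boundary [x = 0]
    of the remaining piece it equals 1, which dominates the solution, and on the
    unit circle it equals 1 as well. *)
Lemma solution_le_exp_polar {R : realType} (rad eps : R) (u : R * R -> R) :
  1 < rad -> 0 < eps -> classical_solution rad eps u ->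
  forall p, closure (Omega rad) p -> p.1 <= 0 ->
  u p <= expR (eps^-1 *
    (p.1 - p.1 * (Num.sqrt (p.1 ^+ 2 + p.2 ^+ 2))^-1)).
Proof.
move=> rad1 eps0 su p Op p0.
pose rho (p : R * R) := (Num.sqrt (p.1 ^+ 2 + p.2 ^+ 2))^-1.
pose phi (p : R * R) := eps^-1 * (p.1 - p.1 * rho p).
pose K := closure (Omega rad) `&` [set r | r.1 <= 0].
have cf := @fst_continuous R.
have n1 r : closure (Omega rad) r -> 1 <= r.1 ^+ 2 + r.2 ^+ 2.
  by move=> /closure_Omega_sub - /(_ rad1)[].
apply: (@comparison R rad eps u (fun r => expR (phi r)) K) => //.
- apply: closedI; first exact: closed_closure.
  by apply: closed_le2; last exact: cst_continuous2.
- by move=> r [].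
- move=> r; rewrite inE => -[Or _].
  apply: (@continuous_comp _ _ _ phi expR); last exact: continuous_expR.
  apply: cvgM; first exact: cvg_cst.
  apply: cvgB; first exact: cf.
  apply: cvgM; first exact: cf.
  apply: cvgV.
    by rewrite gt_eqF // sqrtr_gt0; have := n1 _ Or; lra.
  apply: (@continuous_comp _ _ _ (fun p : R * R => p.1 ^+ 2 + p.2 ^+ 2)
    Num.sqrt); first exact: continuous_sqr_norm.
  exact: sqrt_continuous.
move=> r [Or /= r0].
have /andP[ur0 ur1] := solution_bounds _ _ _ rad1 eps0 su _ Or.
have [r1|r1] := eqVneq r.1 0.
  by constructor 1; rewrite /phi r1 mul0r subr0 mulr0 expR0.
have {}r1 : r.1 < 0 by rewrite lt_neqAle r1.
have [Or'|br|[br1 br2]|br] := closure_OmegaP _ _ rad1 Or.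
- constructor 2; split => //.
    have : nbhs r (Omega rad `&` [set r | r.1 < 0]).
      apply: open_nbhs_nbhs; split => //; apply: openI; first exact: Omega_open.
      by apply: open_lt2; last exact: cst_continuous2.
    by apply: filterS => r' [? /ltW ?]; split => //; exact: subset_closure.
  have nr0 : 0 < r.1 ^+ 2 + r.2 ^+ 2 by have := n1 _ Or; lra.
  have nr0' : 0 < r.2 ^+ 2 + r.1 ^+ 2 by rewrite addrC.
  pose z := rho r.
  have z0 : 0 < z by rewrite /z /rho invr_gt0 sqrtr_gt0.
  have z2 : z ^+ 2 * (r.1 ^+ 2 + r.2 ^+ 2) = 1.
    by rewrite /z /rho exprVn sqr_sqrtr ?ltW // mulVf // gt_eqF.
  have z1 : z <= 1.
    by rewrite /z /rho invf_le1 ?sqrtr_gt0 // -sqrtr1 ler_wsqrtr // n1.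
  have jx := jet2_comb _ _ (- eps^-1) _ _ _ _ _ (jet2_affine eps^-1 0 r.1)
    (jet2_id_inv_radius _ _ nr0).
  have jy := jet2_comb _ _ (- (eps^-1 * r.1)) _ _ _ _ _
    (jet2_affine 0 (eps^-1 * r.1) r.2) (jet2_inv_radius _ _ nr0').
  move: jx jy; rewrite /= (addrC (r.2 ^+ 2)) -/(rho r) -/z => jx jy.
  apply: jets_expR; first split.
  + rewrite (_ : (fun t => _) = (fun t => eps^-1 * t + 0 +
      - eps^-1 * (t * (Num.sqrt (t ^+ 2 + r.2 ^+ 2))^-1))); first exact: jx.
    by apply/funext => t; rewrite /phi /rho /=; ring.
  + rewrite (_ : (fun t => _) = (fun t => 0 * t + eps^-1 * r.1 +
      - (eps^-1 * r.1) * (Num.sqrt (t ^+ 2 + r.1 ^+ 2))^-1)); first exact: jy.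
    apply/funext => t; rewrite /phi /rho /= (addrC (t ^+ 2)); ring.
  + exact: polar_exponent_super.
- by constructor 1; rewrite (sol_bdO su) // expR_ge0.
- by move: br1; lra.
- constructor 1; rewrite (sol_bdI su) // /phi /rho.
  by move: br => /= ->; rewrite sqrtr1 invr1 mulr1 subrr mulr0 expR0.
Qed.

Theorem theorem4 (R : realType) (rad : R) (hrad : 1 < rad)
    (mu : R) (hmu : 0 < mu) :
  exists eps0 C : R, 0 < eps0 /\ 0 < C /\
    forall eps : R, 0 < eps -> eps <= eps0 ->
    forall u : R * R -> R, classical_solution rad eps u ->
    [/\ (* (a) *)
        forall p : R * R, closure (Omega rad) p -> 0 <= u p <= 1,
        (* (b) *)
        forall r theta : R, closure (Omega rad) (polar r theta) ->
          cos theta <= 0 -> 1 <= r ->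
          u (polar r theta) <= C * expR (cos theta * (r - 1) / eps),
        (* (c) *)
        forall x y : R, closure (Omega rad) (x, y) ->
          1 <= `|y| -> - rad < x < rad ->
          u (x, y) <= C * expR (- (`|y| - 1) / Num.sqrt eps)
      & (* (d) *)
        forall x y : R, closure (Omega rad) (x, y) ->
          - (eps `^ (1 / 3)) <= x <= eps `^ (1 / 3) ->
          - mu * eps `^ (2 / 3) <= 2^-1 * x ^+ 2 + `|y| - 1
            <= mu * eps `^ (2 / 3) ->
          u (x, y) <=
            C * expR (- (2^-1 * x ^+ 2 + `|y| - 1) / (3 * eps `^ (2 / 3)))].
Proof.
(* The factor exp (4 * rad) absorbs exp (2 * (x + rad)) in (c), and exp mu
   absorbs the bounded exponent in (d). *)
pose C := expR (4 * rad + mu).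
have leC t : t <= 4 * rad + mu -> expR t <= C by rewrite ler_expR.
have C1 : 1 <= C by rewrite -expR0 leC //; lra.
exists 4^-1, C; split; first by lra.
split; first exact: expR_gt0.
move=> eps eps0 eps4 u su; have u01 := solution_bounds _ _ _ hrad eps0 su.
split => //.
- move=> r t Op ct r1; have p0 : (polar r t).1 <= 0.
    by rewrite /polar /= mulr_ge0_le0 //; lra.
  apply: (le_trans (solution_le_exp_polar _ _ _ hrad eps0 su _ Op p0)).
  have -> : (polar r t).1 ^+ 2 + (polar r t).2 ^+ 2 = r ^+ 2.
    by rewrite /polar /= !exprMn -mulrDr cos2Dsin2 mulr1.
  rewrite sqrtr_sqr ger0_norm; last by lra.
  have -> : eps^-1 * ((polar r t).1 - (polar r t).1 * r^-1) =
      cos t * (r - 1) / eps.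
    by rewrite /polar /=; field; rewrite !gt_eqF //; lra.
  by apply: ler_peMl => //; exact: expR_ge0.
- move=> x y Op y1 /andP[_ xr].
  pose s := if 0 <= y then 1 else -1 : R.
  have s2 : s ^+ 2 = 1 by rewrite /s; case: ifP => _; ring.
  have sy : s * y = `|y|.
    rewrite /s; case: ifP => y0; first by rewrite mul1r ger0_norm.
    by rewrite mulN1r ltr0_norm // ltNge y0.
  have := solution_le_exp_y _ _ _ _ hrad eps0 eps4 s2 su _ Op.
  rewrite /= sy => /(_ y1) /le_trans; apply.
  rewrite mulNr expRD; apply: ler_wpM2r; first exact: expR_ge0.
  by apply: leC; lra.
- move=> x y Op _ /andP[_ ymu].
  (* The exponent is at least - mu / 3 in this range, so u <= 1 suffices. *)
  have /andP[_ u1] := u01 _ Op; apply: (le_trans u1).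
  rewrite /C -expRD -[leLHS]expR0 ler_expR.
  have e0 : 0 < eps `^ (2 / 3) by rewrite powR_gt0.
  have : (2^-1 * x ^+ 2 + `|y| - 1) / (3 * eps `^ (2 / 3)) <= mu.
    by rewrite ler_pdivrMr; nra.
  by rewrite mulNr; lra.
Qed.
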